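(* Let $G$ be a finite group and $H$ a subgroup of $G$. Suppose that either $H$ is a $2$-group or at least one of $|H|$ and $|G:H|$ is odd. Then $H$ is a perfect code of $G$ if and only if $H$ is a perfect code of $N_{G}(H)$.
   Context: For a finite group $G$ with identity $1$ and a subset $S\subseteq G\setminus\{1\}$ with $S^{-1}=S$ (possibly $S=\emptyset$), the Cayley graph $\mathrm{Cay}(G,S)$ has vertex set $G$, with $x,y$ adjacent if and only if $yx^{-1}\in S$. A perfect code in a graph $\Gamma$ with vertex set $V$ is a subset $C\subseteq V$ such that no two vertices of $C$ are adjacent and every vertex in $V\setminus C$ is adjacent to exactly one vertex in $C$. A subset (in particular a subgroup) $C$ of $G$ is called a perfect code of $G$ if there exists such an $S$ for which $C$ is a perfect code in $\mathrm{Cay}(G,S)$. $N_G(H)$ denotes the normalizer of $H$ in $G$. A $2$-group is a finite group whose order is a power of $2$. *)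

(* Defs.v *)
From mathcomp Require Import all_boot all_fingroup all_solvable.

Set Implicit Arguments.
Unset Strict Implicit.
Unset Printing Implicit Defensive.

Local Open Scope group_scope.

(* The graph has vertex set V, a subset of the ambient type, and adjacency
   relation e, of which only the values on V matter. *)
Definition perfect_code_in (T : finType) (V : {set T}) (e : rel T)
    (C : {set T}) : Prop :=
  [/\ C \subset V,
      {in C &, forall x y, ~~ e x y}
    & {in V :\: C, forall x, #|[set y in C | e x y]| = 1%N}].

(* Here S^-1 is the set of inverses of elements of S, and G^# is G :\ 1. *)
Definition connection_set (gT : finGroupType) (G : {group gT})
    (S : {set gT}) : Prop :=
  S \subset G^# /\ S^-1 = S.

Definition cayley_adj (gT : finGroupType) (S : {set gT}) : rel gT :=
  fun x y => y * x^-1 \in S.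

Definition perfect_code (gT : finGroupType) (G : {group gT})
    (C : {set gT}) : Prop :=
  exists2 S : {set gT},
    connection_set G S & perfect_code_in G (cayley_adj S) C.

(* Main.v *)
Require Import Defs.
From mathcomp Require Import all_boot all_fingroup all_solvable.

(** In [Cay(G, S)] the neighbours of [x] in [H] correspond to the elements of
    [S] in the right coset [H :* x^-1]. So [H] is a perfect code of [G] exactly
    when the right cosets of [H] in [G] other than [H] have an inverse-closed
    set [S] of representatives. Intersecting [S] with the normaliser gives one
    implication. For the other, the existence of [S] is reduced to a local
    condition [perfect_code_of_square_roots]: whenever [x * x \in H] and
    [#|H : H :&: H :^ x|] is odd, [H :* x] contains a square root of 1.

    The reason is a pairing argument inside double cosets. Every left coset
    contained in [H x H] meets every right coset contained in it, so any right
    coset in [H x H] and any right coset in the inverse double coset have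
    representatives that are inverse to each other. Pairing cosets in this way
    leaves nothing over, except possibly one coset when [H x H] is its own
    inverse and consists of an odd number, [#|H : H :&: H :^ x|], of right
    cosets; that coset needs a representative which is its own inverse. The
    pairing is carried out by showing that an inverse-closed partial
    transversal of maximal size misses no coset
    ([maximal_partial_transversal_covers]).

    The local condition then holds in each case. If [H] is a 2-group, an odd
    index [#|H : H :&: H :^ x|] is 1, so [x] normalises [H] and the involution
    comes from a connection set for the normaliser
    ([perfect_code_norm_involution]). If [#|H|] is odd, a suitable odd power of
    [x] works ([odd_card_involution]). If [#|G : H|] is odd, [x] lies in [H]
    and 1 works ([odd_index_mem]). In the two odd cases [H] is thus a perfect
    code of [G] outright. *)

Set Implicit Arguments.
Unset Strict Implicit.
Unset Printing Implicit Defensive.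

Local Open Scope group_scope.

(** * Inverse-closed partial transversals *)

(** Inversion pairs off the elements of [T] that differ from their inverses. *)
Lemma odd_inv_closed_fixed (gT : finGroupType) (T : {set gT}) :
  T^-1 = T -> odd #|T| -> exists2 t, t \in T & t^-1 = t.
Proof.
have [n] := ubnP #|T|; elim: n T => // n IHn T leTn invT oddT.
have memV u : (u^-1 \in T) = (u \in T) by rewrite -{1}invT mem_invg invgK.
have [t tT] : exists t, t \in T.
  by apply/set0Pn; apply: contraL oddT => /eqP->; rewrite cards0.
have [?|neq_t] := eqVneq t^-1 t; first by exists t.
have cardT : #|T| = #|T :\ t :\ t^-1|.+2.
  by rewrite (cardsD1 t) tT (cardsD1 t^-1 (T :\ t)) !inE memV tT neq_t.
have [|||u] := IHn (T :\ t :\ t^-1).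
- by rewrite ltnS in leTn; apply: leq_trans leTn; rewrite cardT.
- apply/setP=> u; rewrite mem_invg !inE memV (inj_eq invg_inj).
  by rewrite -[u^-1 == t]eqg_inv invgK andbCA.
- by move: oddT; rewrite cardT /= negbK.
by rewrite !inE => /and3P[_ _ uT] invu; exists u.
Qed.

Section PartialTransversal.

Variables (gT : finGroupType) (G H : {group gT}).
Implicit Types (S T : {set gT}) (s t w x y : gT).

Definition coset_free S :=
  [forall s in S, forall t in S, (s * t^-1 \in H) ==> (s == t)].

Lemma coset_freeP S :
  reflect {in S &, forall s t, s * t^-1 \in H -> s = t} (coset_free S).
Proof.
apply: (iffP forall_inP) => [freeS s t sS tS sHt | freeS s sS].
  by apply/eqP; apply: (implyP (forall_inP (freeS s sS) t tS)).
by apply/forall_inP=> t tS; apply/implyP=> /freeS->.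
Qed.

Lemma coset_freeS S T : S \subset T -> coset_free T -> coset_free S.
Proof.
move=> /subsetP sST /coset_freeP freeT; apply/coset_freeP=> s t sS tS.
by apply: freeT; apply: sST.
Qed.

Lemma card_mul_coset_free S : coset_free S -> #|H * S| = (#|H| * #|S|)%N.
Proof.
move/coset_freeP=> freeS; rewrite -cardsX.
have -> : H * S = uncurry mulg @: setX H S by rewrite -curry_imset2X.
rewrite card_in_imset // => -[h s] [k t] /setXP[/= hH sS] /setXP[/= kH tS] eq.
have eq_st : s = t.
  apply: freeS => //.
  by rewrite -(mulKg h s) eq mulgA mulgK groupM ?groupV.
by move: eq; rewrite eq_st => /mulIg->.
Qed.

(** Membership in [H * S] says that the coset of a point is represented in
    [S], which is how missed cosets are expressed below. *)
Lemma mem_mul_rcoset S x s : s \in H :* x -> (s \in H * S) = (x \in H * S).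
Proof.
case/rcosetP=> h hH ->; apply/mulsgP/mulsgP => -[k t kH tS eq].
  by exists (h^-1 * k) t; rewrite ?groupM ?groupV // -mulgA -eq mulKg.
by exists (h * k) t; rewrite ?groupM // -mulgA -eq.
Qed.

Lemma rcoset_setD x y :
  H \subset G -> y \in H :* x -> x \in G :\: H -> y \in G :\: H.
Proof.
by move=> sHG /rcosetP[h hH ->]; rewrite !inE !groupMl // (subsetP sHG).
Qed.

Lemma inv_double_coset x : (H :* x * H)^-1 = H :* x^-1 * H.
Proof. by rewrite !invMg invGid invg_set1 mulgA. Qed.

(** Every left coset inside a double coset meets every right coset inside it;
    here the left coset is the set of inverses of [H :* y]. *)
Lemma double_coset_meet x y :
  y^-1 \in H :* x * H -> exists2 s, s \in H :* x & s^-1 \in H :* y.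
Proof.
case/mulsgP=> s k sHx kH eq; exists s => //.
by rewrite mem_rcoset -invMg groupV -[y]invgK eq invMg mulgKV groupV.
Qed.

(** The double coset is a left translate of the product of [H :^ x] and [H]. *)
Lemma card_double_coset x :
  #|H :* x * H| = (#|H| * #|H : H :&: H :^ x|)%N.
Proof.
have -> : H :* x * H = x *: ((H :^ x)%G * H).
  by rewrite /= mulgA conjsgE lcosetKV.
rewrite card_lcoset.
have := mul_cardG (H :^ x)%G H.
rewrite cardJg -(Lagrange (subsetIl H (H :^ x))) [(H :^ x)%G :&: _]setIC.
move=> eq; apply/eqP; rewrite -(eqn_pmul2r (cardG_gt0 (H :&: H :^ x)%G)) -eq.
by rewrite -!mulnA [(_ * #|_ :&: _|)%N]mulnC.
Qed.

Lemma coset_freeU1 S w :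
  coset_free S -> w \notin H * S -> coset_free (w |: S).
Proof.
move=> /coset_freeP freeS missw.
have missed s : s \in S -> w * s^-1 \notin H.
  by move=> sS; apply: contra missw => ?; rewrite -(mulgKV s w) mem_mulg.
apply/coset_freeP=> s t /setU1P[->|sS] /setU1P[->|tS] //.
- by rewrite (negPf (missed t tS)).
- by rewrite -groupV invMg invgK (negPf (missed s sS)).
exact: freeS.
Qed.

Definition partial_transversal S :=
  [&& S \subset G :\: H, S^-1 == S & coset_free S].

(** The last hypothesis covers the case where [w] and [w^-1] lie in the same
    right coset of [H], which can hold only one representative. *)
Lemma partial_transversalU S w :
    partial_transversal S -> w \in G :\: H ->
    w \notin H * S -> w^-1 \notin H * S -> (w * w \in H -> w^-1 = w) ->
  partial_transversal (w |: (w^-1 |: S)).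
Proof.
case/and3P=> sSGH /eqP invS freeS wGH missw misswV invw.
apply/and3P; split.
- rewrite !subUset !sub1set sSGH wGH /= andbT.
  by move: wGH; rewrite !inE !groupV.
- apply/eqP/setP=> u; rewrite mem_invg !inE -mem_invg invS.
  by rewrite (inj_eq invg_inj) -[u^-1 == w]eqg_inv invgK orbCA.
have [invw1 | neq_w] := eqVneq w^-1 w.
  by rewrite invw1 setUA setUid coset_freeU1.
apply: coset_freeU1; first exact: coset_freeU1.
rewrite mulgU inE negb_or missw andbT.
by rewrite mem_rcoset invgK; apply: contra neq_w => /invw/eqP.
Qed.

Lemma subset_partial_transversal S T :
  T \subset S -> T^-1 = T -> partial_transversal S -> partial_transversal T.
Proof.
move=> sTS invT /and3P[sSGH _ freeS]; apply/and3P; split.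
- exact: subset_trans sTS sSGH.
- exact/eqP.
- exact: coset_freeS freeS.
Qed.

(** The neighbours of [x] in [H] are the [h^-1] with [x^-1 = h * s] and [s] in
    [S]; covering gives one and coset-freeness makes it unique. *)
Lemma perfect_code_of_transversal S :
    H \subset G -> partial_transversal S -> G :\: H \subset H * S ->
  perfect_code G H.
Proof.
move=> sHG /and3P[sSGH /eqP invS /coset_freeP freeS] /subsetP coverS; exists S.
  split=> //; apply: subset_trans sSGH _; apply/subsetP=> s.
  by rewrite !inE => /andP[sH ->]; rewrite andbT; apply: contraNneq sH => ->.
split=> // [x y xH yH | x xGH].
  apply/negP=> /(subsetP sSGH).
  by rewrite inE groupM ?groupV.
have /coverS/mulsgP[h s hH sS eq] : x^-1 \in G :\: H.
  by move: xGH; rewrite !inE !groupV.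
apply/eqP/cards1P; exists h^-1; apply/setP=> y; rewrite !inE /cayley_adj.
apply/andP/eqP=> [[yH] | ->]; last by rewrite groupV eq mulKg.
rewrite eq mulgA => yhsS.
have: y * h * s = s by apply: freeS => //; rewrite mulgK groupM.
by move/(canRL (mulgK s)); rewrite mulgV => /(canRL (mulgK h)); rewrite mul1g.
Qed.

(** A double coset and its inverse have the same size, hence contain equally
    many right cosets, and inversion matches the elements of [S] in one with
    those in the other; so if [S] misses a coset in one, it does in the other. *)
Lemma exists_missed_inverse S x :
    S^-1 = S -> coset_free S -> x \notin H * S ->
  exists2 y, y^-1 \in H :* x * H & y \notin H * S.
Proof.
move=> invS freeS missx; set D := H :* x * H.
have HD : H * D = D by rewrite !mulgA mulGid.
have HDV : H * D^-1 = D^-1 by rewrite inv_double_coset !mulgA mulGid.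
have freeI B : coset_free (S :&: B) by exact: coset_freeS (subsetIl S B) freeS.
have cardD : #|H * (S :&: D^-1)| < #|D^-1|.
  rewrite card_mul_coset_free // -{1}invS -invIg !card_invg.
  rewrite -card_mul_coset_free //.
  apply: proper_card; rewrite properE -{2}HD mulgS ?subsetIr //=.
  apply/subsetPn; exists x; last first.
    by apply: contra missx; apply: subsetP; rewrite mulgS ?subsetIl.
  by rewrite -[x]mulg1 mem_mulg ?rcoset_refl.
have [y yD missy] : exists2 y, y \in D^-1 & y \notin H * (S :&: D^-1).
  by apply/subsetPn/negP=> /subset_leq_card; rewrite leqNgt cardD.
exists y; first by rewrite -mem_invg.
apply: contra missy => /mulsgP[h s hH sS eq]; rewrite eq mem_mulg // inE sS.
by rewrite -(mulKg h s) -eq -HDV mem_mulg ?groupV.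
Qed.

(** An involution [t] of [S] can be traded for a pair [w], [w^-1] whose cosets
    are that of [s] and that of [t]: the coset of [t] stays covered, and the
    coset of [s] becomes so. *)
Lemma partial_transversal_swap S s t :
    H \subset G -> partial_transversal S -> s \in G :\: H -> s \notin H * S ->
    t \in S -> t^-1 = t -> t \in H :* s * H ->
  exists2 T, partial_transversal T & #|S| < #|T|.
Proof.
move=> sHG ptS sGH misss tS invt tD.
have [sSGH /eqP invS freeS] := and3P ptS.
have [|w wHs wVHt] := @double_coset_meet s t; first by rewrite invt.
have wGH : w \in G :\: H.
  exact: (rcoset_setD sHG wHs sGH).
have ptS' : partial_transversal (S :\ t).
  apply: subset_partial_transversal ptS; first exact: subD1set.
  apply/setP=> u; rewrite mem_invg !inE -mem_invg invS.
  by rewrite -[u^-1 == t]eqg_inv invgK invt.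
have missw : w \notin H * S by rewrite (mem_mul_rcoset _ wHs).
have missw' : w \notin H * (S :\ t).
  by apply: contra missw; apply: subsetP; rewrite mulgS ?subD1set.
have nwwH : w * w \notin H.
  apply: contra missw => wwH; rewrite (@mem_mul_rcoset _ t).
    exact: (subsetP (mulG_subr H S)).
  by rewrite -(rcoset_eqP wVHt) mem_rcoset invgK.
have misswV' : w^-1 \notin H * (S :\ t).
  rewrite (mem_mul_rcoset _ wVHt); apply/mulsgP=> -[h t' hH].
  rewrite !inE => /andP[/eqP nt t'S] eq; apply: nt; apply/esym.
  by apply: (coset_freeP _ freeS) => //; rewrite eq mulgK.
exists (w |: (w^-1 |: S :\ t)).
  by apply: partial_transversalU => // wwH; case/negP: nwwH.
have wN := contra (subsetP (mulG_subr H _) w) missw'.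
have wVN := contra (subsetP (mulG_subr H _) w^-1) misswV'.
have neq_wV : w != w^-1.
  by apply: contra nwwH => /eqP eq_w; rewrite {2}eq_w mulgV.
have wN' : w \notin w^-1 |: S :\ t by rewrite in_setU1 negb_or neq_wV.
by rewrite !cardsU1 (cardsD1 t S) tS wN' wVN.
Qed.

(** Take a missed coset inside [H :* x * H]. By [exists_missed_inverse] some
    coset [H :* y] inside the inverse double coset is missed as well, and
    [double_coset_meet] gives [s] in [H :* x] with [s^-1] in [H :* y]. Adding
    [s] and [s^-1] would contradict maximality unless these two cosets are
    equal, that is, [s * s \in H]. If the number of right cosets in
    [H :* s * H] is odd, the hypothesis on square roots gives an involution
    that can be added alone. If it is even, [H :* s] is the only missed coset
    of the double coset, as any other one could be added together with it;
    so [S] has an odd number of elements in the double coset, one of them is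
    an involution, and a swap enlarges [S]. *)
Lemma maximal_partial_transversal_covers S :
    H \subset G ->
    {in G, forall x, x * x \in H -> odd #|H : H :&: H :^ x| ->
       exists2 y, y \in H :* x & y * y = 1} ->
    partial_transversal S ->
    (forall T, partial_transversal T -> #|T| <= #|S|) ->
  G :\: H \subset H * S.
Proof.
move=> sHG hypG ptS maxS; apply/subsetPn=> -[x xGH missx].
have [sSGH /eqP invS freeS] := and3P ptS.
have rcosetGH a b := @rcoset_setD a b sHG.
have missH a b : b \in H :* a -> a \notin H * S -> b \notin H * S.
  by move/mem_mul_rcoset->.
have noext w : w \in G :\: H -> w \notin H * S -> w^-1 \notin H * S ->
    (w * w \in H -> w^-1 = w) -> False.
  move=> wGH mw mwV invw.
  have := maxS _ (partial_transversalU ptS wGH mw mwV invw).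
  apply/negP; rewrite -ltnNge; apply: proper_card.
  rewrite properE setUCA [_ |: (w |: S)]setUA subsetUr.
  apply/subsetPn; exists w.
    by rewrite !inE eqxx orbT.
  by apply: contra mw => wS; rewrite -[w]mul1g mem_mulg.
(* By maximality, two missed cosets that can be matched must coincide. *)
have missed_square a b : a \in G :\: H -> a \notin H * S -> b \notin H * S ->
    b^-1 \in H :* a * H ->
    exists2 s, s \in H :* a & s^-1 \in H :* b /\ s * s \in H.
  move=> aGH ma mb /double_coset_meet[s sHa sVHb]; exists s => //; split=> //.
  apply/negPn/negP=> ssH; apply: (noext s); rewrite ?(rcosetGH _ _ sHa) //.
  - exact: missH sHa _.
  - exact: missH sVHb _.
  - by move=> ?; case/negP: ssH.
have [y yVD missy] := exists_missed_inverse invS freeS missx.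
have [s sHx [_ ssH]] := missed_square _ _ xGH missx missy yVD.
have sGH := rcosetGH _ _ sHx xGH; have misss := missH _ _ sHx missx.
have [sG _] := setDP sGH.
have sVHs : s^-1 \in H :* s by rewrite mem_rcoset -invMg groupV.
have [odd_n | even_n] := boolP (odd #|H : H :&: H :^ s|).
  have [u uHs uu] := hypG s sG ssH odd_n.
  have invu : u^-1 = u by apply/eqP; rewrite eq_invg_mul uu.
  have missu := missH _ _ uHs misss.
  by apply: (noext u); rewrite ?invu ?(rcosetGH _ _ uHs).
set D := H :* s * H.
have invD : D^-1 = D.
  by rewrite inv_double_coset (rcoset_eqP sVHs).
have HD : H * D = D by rewrite !mulgA mulGid.
have sD : s \in D by rewrite -[s]mulg1 mem_mulg ?rcoset_refl.
(* [H :* s] is the only missed coset in [D]. *)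
have defD : D = H * (s |: (S :&: D)).
  have sTD : s |: (S :&: D) \subset D by rewrite subUset sub1set sD subsetIr.
  have sHTD : H * (s |: (S :&: D)) \subset D.
    by apply: subset_trans (mulgS H sTD) _; rewrite HD.
  apply/eqP; rewrite eqEsubset sHTD andbT.
  apply/subsetP=> z zD.
  rewrite mulgU inE; have [zS | missz] := boolP (z \in H * S).
    case/mulsgP: zS => h t hH tS eq; apply/orP; right.
    by rewrite eq mem_mulg // inE tS -(mulKg h t) -eq -HD mem_mulg ?groupV.
  apply/orP; left.
  have [|w wHs [wVHz wwH]] := missed_square _ _ sGH misss missz.
    by rewrite -mem_invg invD.
  rewrite -(rcoset_eqP wHs) rcoset_sym -(rcoset_eqP wVHz) mem_rcoset invgK.
  exact: wwH.
have freeU : coset_free (s |: (S :&: D)).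
  apply: coset_freeU1; first exact: coset_freeS (subsetIl S D) freeS.
  by apply: contra misss; apply: subsetP; rewrite mulgS ?subsetIl.
have oddSD : odd #|S :&: D|.
  have := card_double_coset s; rewrite -/D {1}defD card_mul_coset_free //.
  move/eqP; rewrite eqn_pmul2l ?cardG_gt0 // => /eqP cardU.
  move: even_n; rewrite -cardU cardsU1 inE.
  have /negPf-> : s \notin S.
    by apply: contra misss => sS; rewrite -[s]mul1g mem_mulg.
  by rewrite /= negbK.
have [|t /setIP[tS tD] invt] := odd_inv_closed_fixed _ oddSD.
  by rewrite invIg invS invD.
have [T ptT] := partial_transversal_swap sHG ptS sGH misss tS invt tD.
by rewrite ltnNge maxS.
Qed.

Lemma perfect_code_of_square_roots :
    H \subset G ->
    {in G, forall x, x * x \in H -> odd #|H : H :&: H :^ x| ->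
       exists2 y, y \in H :* x & y * y = 1} ->
  perfect_code G H.
Proof.
move=> sHG hypG; have pt0 : partial_transversal set0.
  apply/and3P; split; first exact: sub0set.
    by apply/eqP/setP=> u; rewrite mem_invg !inE.
  by apply/coset_freeP=> s t; rewrite inE.
case: (@arg_maxnP _ set0 partial_transversal (fun S => #|S|) pt0) => S ptS maxS.
apply: (perfect_code_of_transversal sHG ptS).
exact: (maximal_partial_transversal_covers sHG hypG ptS maxS).
Qed.

End PartialTransversal.

(** * Square roots of 1 in cosets *)

Lemma perfect_codeS (gT : finGroupType) (K G : {group gT}) (C : {set gT}) :
  C \subset K -> K \subset G -> perfect_code G C -> perfect_code K C.
Proof.
move=> sCK sKG [S [sSG invS] [_ indepC domC]]; exists (S :&: K).
  split; last by rewrite invIg invS invGid.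
  apply/subsetP=> s /setIP[/(subsetP sSG)].
  by rewrite !inE => /andP[-> _].
split=> // [x y xC yC | x /setDP[xK xC]].
  by apply: contra (indepC x y xC yC) => /setIP[].
rewrite -(domC x) ?inE ?xC ?(subsetP sKG) //; apply: eq_card => y.
rewrite !inE /cayley_adj inE; have [yC | //] := boolP (y \in C).
by rewrite (groupM (subsetP sCK y yC)) ?groupV //= andbT.
Qed.

(** As [x] normalises [H] and [x * x] lies in [H], the right coset [H :* x]
    equals its own set of inverses. The connection set [S] meets it in exactly
    one element, which must therefore be its own inverse. *)
Lemma perfect_code_norm_involution (gT : finGroupType) (G H : {group gT}) x :
    perfect_code G H -> x \in 'N_G(H) -> x * x \in H ->
  exists2 y, y \in H :* x & y * y = 1.
Proof.
case=> S [sSG invS] [_ _ domH] /setIP[xG nHx] xxH.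
have [xH | notHx] := boolP (x \in H).
  by exists 1; rewrite ?mulg1 // mem_rcoset mul1g groupV.
have xVGH : x^-1 \in G :\: H by rewrite inE !groupV notHx.
have /eqP/cards1P[h def_h] := domH _ xVGH.
have memS k : k \in H -> k * x \in S -> k = h.
  by move=> kH kxS; apply/set1P; rewrite -def_h inE kH /cayley_adj invgK.
have /setIdP[hH] : h \in [set y in H | cayley_adj S x^-1 y].
  by rewrite def_h set11.
rewrite /cayley_adj invgK => hxS; exists (h * x).
  by rewrite mem_rcoset mulgK.
have kH : (h * x)^-1 * x^-1 \in H.
  rewrite -invMg groupV (_ : x * (h * x) = h ^ x^-1 * (x * x)).
    by rewrite groupM // memJ_norm ?groupV.
  by rewrite conjgE invgK !mulgA mulgKV.
have := memS _ kH; rewrite mulgKV -mem_invg invS => /(_ hxS) eq_h.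
by rewrite -{1}eq_h mulgKV mulVg.
Qed.

(** The order [m] of [x * x] is odd, so [x ^+ m] is [x] multiplied by a power
    of [x * x], and its square is [(x * x) ^+ m = 1]. *)
Lemma odd_card_involution (gT : finGroupType) (H : {group gT}) x :
  odd #|H| -> x * x \in H -> exists2 y, y \in H :* x & y * y = 1.
Proof.
move=> oddH xxH; have odd_m := dvdn_odd (order_dvdG xxH) oddH.
set m := #[x * x] in odd_m.
have xE k : x ^+ k.*2 = (x * x) ^+ k by rewrite -muln2 mulnC expgM expgS expg1.
exists (x ^+ m).
  by rewrite mem_rcoset -(odd_double_half m) odd_m add1n expgSr mulgK xE groupX.
by rewrite -expgD addnn xE expg_order.
Qed.

(** Both [H] and [H :^ x] contain [x * x], so [x] swaps them and normalises
    their intersection [K]. The coset of [x] in ['N_G(K) / K] has order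
    dividing 2, while [#|G : K|] is odd, so this coset is trivial. *)
Lemma odd_index_mem (gT : finGroupType) (G H : {group gT}) x :
    H \subset G -> odd #|G : H| -> x \in G -> x * x \in H ->
    odd #|H : H :&: H :^ x| -> x \in H.
Proof.
move=> sHG oddGH xG xxH; set K := (H :&: H :^ x)%G => oddHK.
have sKH : K \subset H := subsetIl H _.
have nKx : x \in 'N(K).
  by apply/normP; rewrite /= conjIg -conjsgM (conjGid xxH) setIC.
have xxK : x * x \in K.
  by rewrite inE xxH mem_conjg conjgE invgK !mulgA mulgK.
have oddGK : odd #|'N_G(K) : K|.
  have sKN : K \subset 'N_G(K) by rewrite subsetI (subset_trans sKH sHG) normG.
  have := Lagrange_index (subsetIl G 'N(K)) sKN.
  rewrite -(Lagrange_index sHG sKH) => /(congr1 odd).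
  by rewrite !oddM oddGH oddHK => /andP[].
apply: (subsetP sKH); apply: coset_idr => //; apply/eqP; rewrite -order_eq1.
have dvd2 : #[coset K x] %| 2.
  by rewrite order_dvdn -morphX //= expgS expg1 coset_id.
have odd_x : odd #[coset K x].
  apply: dvdn_odd oddGK; rewrite -card_quotient ?subsetIr //.
  by rewrite order_dvdG // mem_quotient // inE xG.
by move: dvd2 odd_x; rewrite dvdn_divisors // !inE => /orP[] /eqP->.
Qed.

(** The index divides a power of 2 and is odd, hence it is 1. *)
Lemma two_group_odd_index_norm (gT : finGroupType) (H : {group gT}) x :
  2.-group H -> odd #|H : H :&: H :^ x| -> x \in 'N(H).
Proof.
move=> pH oddHK; rewrite odd_2'nat in oddHK.
have := pnat_1 (pnat_dvd (dvdn_indexg H (H :&: H :^ x)%G) pH) oddHK.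
move/eqP; rewrite indexg_eq1 subsetI subxx /= => sHHx.
by apply/normP/esym/eqP; rewrite eqEcard sHHx cardJg /=.
Qed.

Theorem theorem3p2 (gT : finGroupType) (G H : {group gT}) :
  H \subset G ->
  2.-group H \/ (odd #|H| \/ odd #|G : H|) ->
  (perfect_code G H <-> perfect_code 'N_G(H)%G H).
Proof.
move=> sHG hypH; have sHN : H \subset 'N_G(H) by rewrite subsetI sHG normG.
split=> [|codeN]; first exact: perfect_codeS sHN (subsetIl _ _).
apply: perfect_code_of_square_roots => // x xG xxH oddHK.
case: hypH => [pH | [oddH | oddGH]].
- have nHx := two_group_odd_index_norm pH oddHK.
  by apply: perfect_code_norm_involution codeN _ xxH; rewrite !in_setI xG nHx.
- exact: odd_card_involution.
exists 1; rewrite ?mulg1 // mem_rcoset mul1g groupV.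
exact: (odd_index_mem sHG oddGH xG xxH oddHK).
Qed.
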